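(* Let $A\in\mathbb{R}^{n\times n}$ be invertible, $B\in\mathbb{R}^{n\times n}$ symmetric positive definite, and let $S$ be a random matrix with $n$ rows which has full column rank with probability $1$ and such that $\mathbf{E}[Z]$ is positive definite. Let $X_0\in\mathbb{R}^{n\times n}$. If $X_k$ is obtained either (1) by applying $k$ iterations of Algorithm 1 (row variant) from $X_0$, or (2) by applying $k$ iterations of Algorithm 3 (symmetric variant) from $X_0$, assuming in this case that both $A$ and $X_0$ are symmetric, then $$\mathbf{E}\left[\|X_k-A^{-1}\|_{F(B)}^2\right]\le\rho^k\,\|X_0-A^{-1}\|_{F(B)}^2,\qquad \rho=1-\lambda_{\min}(B^{-1/2}\mathbf{E}[Z]B^{-1/2}).$$
   Context: $Z=A^\top S(S^\top AB^{-1}A^\top S)^{-1}S^\top A$. $\|X\|_{F(B)}^2=\mathrm{Tr}(X^\top BXB)=\|B^{1/2}XB^{1/2}\|_F^2$; $\lambda_{\min}$ is the smallest eigenvalue; $B^{-1/2}$ is the symmetric positive definite square root of $B^{-1}$. Algorithm 1 (row variant): given deterministic $X_0\in\mathbb{R}^{n\times n}$, in each iteration draw a fresh independent copy of $S$ and set $X_{k+1}=X_k+B^{-1}A^\top S(S^\top AB^{-1}A^\top S)^{-1}S^\top(I-AX_k)$. Algorithm 3 (symmetric variant, $A$ and $X_0$ symmetric): in each iteration draw a fresh independent copy of $S$, set $\Lambda=S(S^\top AB^{-1}AS)^{-1}S^\top$, $\Theta=\Lambda AB^{-1}$, $M_k=X_kA-I$, and $X_{k+1}=X_k-M_k\Theta-(M_k\Theta)^\top+\Theta^\top(AX_kA-A)\Theta$.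 *)

(* Defs.v *)
From HB Require Import structures.
From mathcomp Require Import all_boot all_order all_algebra finmap.
From mathcomp Require Import all_classical all_reals all_analysis.

Set Implicit Arguments.
Unset Strict Implicit.
Unset Printing Implicit Defensive.

Import Order.TTheory GRing.Theory Num.Theory.
Import numFieldNormedType.Exports.

Local Open Scope classical_set_scope.
Local Open Scope ring_scope.

Section MatrixNotions.
Variables (R : realType) (n : nat).
Implicit Types M B X C : 'M[R]_n.

Definition posdefmx M : Prop :=
  M \is symmetricmx /\
  forall x : 'cV[R]_n, x != 0 -> 0 < (x^T *m M *m x) 0 0.

(* The symmetric positive definite square root of M; it exists and is unique
   when M is symmetric positive definite, and is 0 by convention if there is
   none. *)
Definition sqrtmx M : 'M[R]_n :=
  xget 0 [set C | posdefmx C /\ C *m C = M].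

(* The smallest eigenvalue; it exists for a symmetric M when n > 0, and is 0 by
   convention if there is none. *)
Definition lambda_min M : R :=
  xget 0 [set l | eigenvalue M l /\ forall mu, eigenvalue M mu -> l <= mu].

Definition sqnormFB B X : R := \tr (X^T *m B *m X *m B).

End MatrixNotions.

(* Real matrices with n rows and an arbitrary number of columns, with the Borel
   sigma-algebra of the disjoint union of the spaces 'M[R]_(n, q). A random
   matrix with n rows is a random variable with values in this type, so that its
   number of columns may be random as well. *)
Definition nrowmx_sum (R : realType) (n : nat) : Type :=
  {q : nat & 'M[R]_(n, q)}.

HB.instance Definition _ (R : realType) (n : nat) :=
  Topological.copy (nrowmx_sum R n)
    {q : nat & ('M[R]_(n, q) : topologicalType)}.
HB.instance Definition _ (R : realType) (n : nat) :=
  isPointed.Build (nrowmx_sum R n) (existT (fun q => 'M[R]_(n, q)) 0%N 0).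

Definition nrowmx (R : realType) (n : nat) : Type :=
  g_sigma_algebraType (@open (nrowmx_sum R n)).

HB.instance Definition _ (R : realType) (n : nat) :=
  Measurable.copy (nrowmx R n) (g_sigma_algebraType (@open (nrowmx_sum R n))).

Section Sketch.
Variables (R : realType) (n : nat).
Implicit Types (A B X : 'M[R]_n) (s : nrowmx R n).

Definition ncols s : nat := projT1 s.
Definition sketchmx s : 'M[R]_(n, ncols s) := projT2 s.

Definition full_col_rank s : Prop := \rank (sketchmx s) = ncols s.

(* In the next three definitions the inverted matrix is invertible as soon as S
   has full column rank (A being invertible, and symmetric in the last one, and B
   positive definite). *)
Definition Zmx A B s : 'M[R]_n :=
  let S := sketchmx s in
  A^T *m S *m invmx (S^T *m A *m invmx B *m A^T *m S) *m S^T *m A.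

Definition row_step A B X s : 'M[R]_n :=
  let S := sketchmx s in
  X + invmx B *m A^T *m S *m invmx (S^T *m A *m invmx B *m A^T *m S) *m S^T
        *m (1%:M - A *m X).

Definition sym_step A B X s : 'M[R]_n :=
  let S := sketchmx s in
  let Lambda := S *m invmx (S^T *m A *m invmx B *m A *m S) *m S^T in
  let Theta := Lambda *m A *m invmx B in
  let M := X *m A - 1%:M in
  X - M *m Theta - (M *m Theta)^T + Theta^T *m (A *m X *m A - A) *m Theta.

Fixpoint iterates (step : 'M[R]_n -> nrowmx R n -> 'M[R]_n) X0
    (s : nat -> nrowmx R n) (k : nat) : 'M[R]_n :=
  if k is j.+1 then step (iterates step X0 s j) (s j) else X0.

End Sketch.

Section Probability.
Context {d : measure_display} {T : measurableType d} {R : realType}.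
Variable P : probability T R.

Definition mutually_independent {d'} {T' : measurableType d'}
    (X : nat -> {RV P >-> T'}) : Prop :=
  forall (J : {fset nat}) (U : nat -> set T'),
    (forall j, measurable (U j)) ->
    P (\bigcap_(j in [set` J]) (X j @^-1` U j)) =
      (\prod_(j <- J) P (X j @^-1` U j))%E.

(* X is a sequence of independent copies of Y. *)
Definition iid_copies {d'} {T' : measurableType d'}
    (Y : {RV P >-> T'}) (X : nat -> {RV P >-> T'}) : Prop :=
  mutually_independent X /\
  forall j (U : set T'), measurable U ->
    distribution P (X j) U = distribution P Y U.

Definition expectmx {m n : nat} (M : T -> 'M[R]_(m, n)) : 'M[R]_(m, n) :=
  \matrix_(i, j) fine ('E_P[fun t => M t i j])%E.

Definition rho {n : nat} (A B : 'M[R]_n) (S : {RV P >-> nrowmx R n}) : R :=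
  let C := sqrtmx (invmx B) in
  1 - lambda_min (C *m expectmx (fun t => Zmx A B (S t)) *m C).

End Probability.

(* Main.v *)
Require Import Defs.
From HB Require Import structures.
From mathcomp Require Import all_boot all_order all_algebra finmap.
From mathcomp Require Import all_classical all_reals all_analysis.
From mathcomp Require Import measurable_realfun lra ring.

(* For R = X - A^-1 both steps multiply R by Q = 1 - B^-1 Z on the left, and the
   symmetric one also by Q^T on the right. When S has full column rank, Z is
   positive semidefinite and Z B^-1 Z = Z, so Q^T B Q = B - Z; hence in both cases
   the squared norm of R drops by at least tr(R^T Z R B). By Rayleigh's principle
   the expectation tr(R^T E[Z] R B) of this drop is at least lambda_min times the
   squared norm of R. The step is iterated by Fubini-Tonelli: the k-th sketch is
   independent of the sigma-algebra generated by the previous ones. *)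

Set Implicit Arguments.
Unset Strict Implicit.
Unset Printing Implicit Defensive.

Import Order.TTheory GRing.Theory Num.Theory.
Import numFieldNormedType.Exports.

Local Open Scope classical_set_scope.
Local Open Scope ring_scope.

(** * Positive semidefinite matrices *)

Section QuadraticForms.
Variable R : realType.

Definition qform n (M : 'M[R]_n) (x : 'cV[R]_n) : R := (x^T *m M *m x) 0 0.

Definition psdmx n (M : 'M[R]_n) : Prop :=
  M^T = M /\ forall x, 0 <= qform M x.

Lemma symmetricmx_tr n (M : 'M[R]_n) : M \is symmetricmx <-> M^T = M.
Proof.
rewrite is_hermitianmxE expr0 scale1r map_mx_id_in //.
by split=> [/eqP {2}->|->].
Qed.

Lemma posdefmx_psd n (M : 'M[R]_n) : posdefmx M -> psdmx M.
Proof.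
move=> [/symmetricmx_tr sM pM]; split=> // x.
have [->|/pM /ltW //] := eqVneq x 0.
by rewrite /qform mulmx0 mxE.
Qed.

Lemma psdmx_congr m n (M : 'M[R]_m) (Y : 'M[R]_(m, n)) :
  psdmx M -> psdmx (Y^T *m M *m Y).
Proof.
move=> [sM pM]; split=> [|x]; first by rewrite !trmx_mul trmxK sM mulmxA.
by have := pM (Y *m x); rewrite /qform trmx_mul !mulmxA.
Qed.

Lemma trmx11 (N : 'M[R]_1) : N^T = N.
Proof. by apply/matrixP => i j; rewrite mxE !ord1. Qed.

Lemma bilin_sym n (M : 'M[R]_n) (x y : 'cV[R]_n) : M^T = M ->
  (y^T *m M *m x) 0 0 = (x^T *m M *m y) 0 0.
Proof.
move=> sM; suff -> : y^T *m M *m x = x^T *m M *m y by [].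
by rewrite -[LHS]trmx11 !trmx_mul trmxK sM mulmxA.
Qed.

Lemma qformD n (M : 'M[R]_n) (x y : 'cV[R]_n) (t : R) : M^T = M ->
  qform M (x + t *: y) =
    qform M x + 2 * t * (x^T *m M *m y) 0 0 + t ^+ 2 * qform M y.
Proof.
move=> sM; rewrite {1}/qform.
have -> : (x + t *: y)^T = x^T + t *: y^T by rewrite linearD linearZ.
have D (a b : 'M[R]_1) i j : (a + b) i j = a i j + b i j by rewrite mxE.
have Z c (a : 'M[R]_1) i j : (c *: a) i j = c * a i j by rewrite mxE.
rewrite !mulmxDl !mulmxDr -!scalemxAl -!scalemxAr !(D, Z) -!/(qform _ _).
by rewrite (bilin_sym x y sM); ring.
Qed.

(* The discriminant of the nonnegative polynomial t |-> qform M (x + t y). *)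
Lemma psdmx_cauchy_schwarz n (M : 'M[R]_n) (x y : 'cV[R]_n) : psdmx M ->
  (x^T *m M *m y) 0 0 ^+ 2 <= qform M x * qform M y.
Proof.
move=> [sM pM]; set b := (_ *m _) 0 0.
have := pM y; rewrite le_eqVlt => /orP[/eqP y0|y0].
  rewrite -y0 mulr0; have [->|b0] := eqVneq b 0; first by rewrite expr0n.
  (* If the form vanishes at y, the polynomial is affine in t with slope 2 b; this t brings it to
     the value -1, which is absurd. *)
  have := pM (x + (- (qform M x + 1) / (2 * b)) *: y).
  rewrite (qformD _ _ _ sM) -/b -y0 mulr0 addr0.
  have -> : qform M x + 2 * (- (qform M x + 1) / (2 * b)) * b = - 1 by field.
  by rewrite oppr_ge0 ler10.
have := pM (x + (- b / qform M y) *: y); rewrite (qformD _ _ _ sM) -/b.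
have -> : qform M x + 2 * (- b / qform M y) * b
    + (- b / qform M y) ^+ 2 * qform M y =
    (qform M x * qform M y - b ^+ 2) / qform M y by field; rewrite gt_eqF.
by rewrite pmulr_lge0 ?invr_gt0 // subr_ge0.
Qed.

Lemma bilin_delta n (M : 'M[R]_n) (i j : 'I_n) :
  ((delta_mx i (0 : 'I_1))^T *m M *m delta_mx j (0 : 'I_1)) 0 0 = M i j.
Proof. by rewrite trmx_delta -rowE -colE !mxE. Qed.

Lemma psdmx_diag_ge0 n (M : 'M[R]_n) i : psdmx M -> 0 <= M i i.
Proof. by move=> [_ /(_ (delta_mx i 0))]; rewrite /qform bilin_delta. Qed.

Lemma psdmx_entry_sqr_le n (M : 'M[R]_n) i j : psdmx M ->
  M i j ^+ 2 <= M i i * M j j.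
Proof.
move=> /(psdmx_cauchy_schwarz (delta_mx i 0) (delta_mx j 0)).
by rewrite /qform !bilin_delta.
Qed.

Lemma mxtrace_psd_ge0 n (M : 'M[R]_n) : psdmx M -> 0 <= \tr M.
Proof. by move=> pM; apply: sumr_ge0 => i _; exact: psdmx_diag_ge0. Qed.

(** A Cholesky step: v is the i-th column divided by the square root of [M i i], and the remainder
    is semidefinite by Cauchy-Schwarz against the i-th basis vector. If [M i i = 0], then
    [s^-1 = 0], so v = 0, and row i vanishes already. The last clause preserves the rows cleared
    earlier. *)
Lemma psdmx_deflate n (M : 'M[R]_n) (i : 'I_n) : psdmx M ->
  exists v : 'cV[R]_n, [/\ psdmx (M - v *m v^T),
    row i (M - v *m v^T) = 0 &
    forall j, row j M = 0 -> row j (M - v *m v^T) = 0].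
Proof.
move=> pM; have [sM _] := pM.
pose s := Num.sqrt (M i i); pose v := s^-1 *: col i M.
have vE j : v j 0 = M j i / s by rewrite !mxE mulrC.
have vvE j k : (v *m v^T) j k = M j i * M k i / M i i.
  rewrite mxE big_ord1 [v^T _ _]mxE !vE mulrACA -invfM -expr2 sqr_sqrtr //.
  exact: psdmx_diag_ge0.
have DE j k : (M - v *m v^T) j k = M j k - M j i * M k i / M i i.
  by rewrite -vvE [LHS]mxE; congr (_ + _); rewrite [LHS]mxE.
have Mij j k : M j k = M k j by rewrite -[in LHS]sM mxE.
exists v; split.
- split=> [|x]; first by rewrite linearB /= trmx_mul trmxK sM.
  rewrite /qform mulmxBr mulmxBl [X in 0 <= X]mxE [X in _ + X]mxE.
  have -> : (x^T *m (v *m v^T) *m x) 0 0 = (x^T *m v) 0 0 ^+ 2.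
    rewrite mulmxA -mulmxA mxE big_ord1 expr2; congr (_ * _).
    by rewrite -[v^T *m x]trmx11 trmx_mul trmxK.
  have -> : (x^T *m v) 0 0 = s^-1 * (x^T *m col i M) 0 0.
    by rewrite -scalemxAr [LHS]mxE.
  rewrite exprMn exprVn sqr_sqrtr ?psdmx_diag_ge0 //.
  have := psdmx_cauchy_schwarz x (delta_mx i 0) pM.
  rewrite {2}/qform bilin_delta -mulmxA -colE => cs.
  have := psdmx_diag_ge0 i pM; rewrite le_eqVlt => /orP[/eqP<-|Mi].
    by rewrite invr0 mul0r subr0; exact: pM.2.
  by rewrite subr_ge0 mulrC ler_pdivrMr.
- apply/rowP => k; rewrite [LHS]mxE DE [RHS]mxE.
  have [Mi|Mi] := eqVneq (M i i) 0.
    have := psdmx_entry_sqr_le i k pM.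
    rewrite Mi mul0r exprn_even_le0 //= => /eqP ->.
    by rewrite !mul0r subr0.
  by rewrite mulrAC mulfV // mul1r Mij subrr.
- move=> j /rowP rj; apply/rowP => k; have := rj k; have := rj i.
  rewrite 2!mxE => Mji; rewrite 2!mxE => Mjk.
  by rewrite [LHS]mxE DE Mji Mjk !mul0r subr0.
Qed.

(** Repeated deflation splits M into terms v v^T, each of which contributes tr (v v^T N) = v^T N v
    >= 0. *)
Lemma mxtrace_psd_mul_ge0 n (M N : 'M[R]_n) :
  psdmx M -> psdmx N -> 0 <= \tr (M *m N).
Proof.
move=> pM pN.
(* Induction on the number k of rows that may be nonzero, the first n - k being zero. For k + 1,
   deflation at the index n - (k + 1) clears one more row. *)
suff H k : (k <= n)%N -> forall M : 'M[R]_n, psdmx M ->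
    (forall j : 'I_n, (j < n - k)%N -> row j M = 0) -> 0 <= \tr (M *m N).
  by apply: (H n) => // j; rewrite subnn.
elim: k => [|k IH] kn {pM}M pM M0.
  have -> : M = 0.
    by apply/row_matrixP => j; rewrite M0 ?row0 // subn0.
  by rewrite mul0mx mxtrace0.
have in_ : (n - k.+1 < n)%N by rewrite ltn_subrL /= (leq_ltn_trans _ kn).
have [v [pMv vi vj]] := psdmx_deflate (Ordinal in_) pM.
rewrite -[M](subrK (v *m v^T)) mulmxDl mxtraceD addr_ge0 //.
  apply: IH => // [|j]; first exact: ltnW.
  rewrite -(subnSK kn) ltnS leq_eqVlt => /orP[/eqP ji|/M0/vj //].
  by rewrite (_ : j = Ordinal in_) //; apply/val_inj.
rewrite -mulmxA mxtrace_mulC /mxtrace big_ord1; exact: pN.2.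
Qed.

End QuadraticForms.

(** * Positive definite matrices and Rayleigh's principle *)

Section PositiveDefinite.
Variable R : realType.

Lemma posdefmx_congr m n (M : 'M[R]_m) (Y : 'M[R]_(m, n)) :
  posdefmx M -> row_free Y^T -> posdefmx (Y^T *m M *m Y).
Proof.
move=> pM fY; split=> [|x x0].
  by apply/symmetricmx_tr; exact: (psdmx_congr _ (posdefmx_psd pM)).1.
have Yx0 : Y *m x != 0.
  apply: contra_neq x0 => Yx; apply: trmx_inj; apply: (row_free_inj fY).
  by rewrite /= -!trmx_mul Yx mulmx0.
by have := pM.2 _ Yx0; rewrite trmx_mul !mulmxA.
Qed.

Lemma posdefmx_unit n (M : 'M[R]_n) : posdefmx M -> M \in unitmx.
Proof.
move=> [_ pM]; rewrite -row_free_unit -kermx_eq0; apply/eqP/row_matrixP => i.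
rewrite row0; set v := row i _.
have vM : v *m M = 0 by rewrite -row_mul mulmx_ker row0.
apply/eqP; apply: contraT => v0.
have : v^T != 0 by rewrite trmx_eq0.
by move=> /pM; rewrite trmxK vM mul0mx mxE ltxx.
Qed.

Lemma posdefmx_inv n (M : 'M[R]_n) : posdefmx M -> posdefmx (invmx M).
Proof.
move=> pM; have uM := posdefmx_unit pM.
have sM : (invmx M)^T = invmx M by rewrite trmx_inv (posdefmx_psd pM).1.
(* By symmetry, M^-1 = (M^-1)^T M M^-1 is a congruence of M. *)
rewrite -[X in posdefmx X]mul1mx -(mulVmx uM) -{1}sM.
apply: posdefmx_congr => //.
by rewrite sM row_free_unit unitmx_inv.
Qed.

Lemma qform_continuous n (M : 'M[R]_n) :
  continuous (fun v : 'rV[R]_n => (v *m M *m v^T) 0 0).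
Proof.
have -> : (fun v : 'rV[R]_n => (v *m M *m v^T) 0 0) =
    (fun v => \sum_j (\sum_i v 0 i * M i j) * v 0 j).
  apply/funext => v; rewrite mxE; apply: eq_bigr => j _.
  by rewrite mxE [v^T _ _]mxE.
have cs (F : 'I_n -> 'rV[R]_n -> R) : (forall i, continuous (F i)) ->
    continuous (fun v => \sum_i F i v).
  by move=> cF; apply: continuous_big => //; exact: add_continuous.
apply: (cs) => j v; apply: (@continuousM R); last exact: coord_continuous.
have cg : continuous (fun v : 'rV[R]_n => \sum_i v 0 i * M i j).
  apply: (cs) => i w; apply: (@continuousM R); last exact: cst_continuous.
  exact: coord_continuous.
exact: cg.
Qed.

Lemma rv_sqnormE n (v : 'rV[R]_n) : (v *m v^T) 0 0 = \sum_i v 0 i ^+ 2.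
Proof. by rewrite mxE; apply: eq_bigr => i _; rewrite mxE. Qed.

Lemma rv_sqnorm_gt0 n (v : 'rV[R]_n) : v != 0 -> 0 < (v *m v^T) 0 0.
Proof.
move=> v0; rewrite rv_sqnormE lt_def sumr_ge0 => [|i _]; last exact: sqr_ge0.
rewrite andbT; apply: contra v0 => /eqP v0; apply/eqP/rowP => i; rewrite mxE.
by apply/eqP; rewrite -sqrf_eq0 (psumr_eq0P (fun i _ => sqr_ge0 (v 0 i)) v0).
Qed.

(* Minimise the quadratic form over the unit sphere: at a minimiser v with
   value a, the matrix M - a I is positive semidefinite and annihilates v. *)
Lemma rayleigh_min n (M : 'M[R]_n) : M^T = M -> (0 < n)%N ->
  exists2 a, eigenvalue M a & psdmx (M - a%:M).
Proof.
move=> sM n0.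
(* The unit sphere; the factor [1%:M] makes its equation an instance of [qform_continuous]. *)
pose A := [set v : 'rV[R]_n | (v *m 1%:M *m v^T) 0 0 = 1].
pose f (v : 'rV[R]_n) := (v *m M *m v^T) 0 0.
have A0 : A !=set0.
  exists (delta_mx 0 (Ordinal n0)).
  rewrite /A /= mulmx1 rv_sqnormE (bigD1 (Ordinal n0)) //=.
  rewrite big1 => [|i ni]; first by rewrite mxE !eqxx expr1n addr0.
  by rewrite mxE (negPf ni) andbF expr0n.
have cA : compact A.
  pose C := [set v : 'rV[R]_n | forall i, `[(- 1 : R), 1]%classic (v ord0 i)].
  apply: (@subclosed_compact _ A C).
  - rewrite (_ : A = (fun v : 'rV[R]_n => (v *m 1%:M *m v^T) 0 0) @^-1` [set 1]) //.
    apply: closed_comp => [v _|]; first exact: qform_continuous.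
    exact: closed_eq.
  - apply: (@rV_compact R n (fun=> `[(- 1), 1]%classic)) => i.
    exact: segment_compact.
  - move=> v; rewrite /A /= mulmx1 rv_sqnormE => v1 i /=.
    rewrite in_itv /= -ler_norml -(@expr_le1 _ 2) // real_normK ?num_real //.
    rewrite -v1 (bigD1 i) //= lerDl; apply: sumr_ge0 => j _; exact: sqr_ge0.
have [|v] := EVT_min_rV (f := f) A0 cA.
  apply: continuous_subspaceT; exact: qform_continuous.
rewrite inE /A /= mulmx1 => v1 vmin.
have sN : (M - (f v)%:M)^T = M - (f v)%:M.
  by rewrite linearB /= sM tr_scalar_mx.
have qE (x : 'cV[R]_n) :
    qform (M - (f v)%:M) x = f x^T - f v * (x^T *m x) 0 0.
  rewrite /qform /f mulmxBr mulmxBl trmxK [LHS]mxE; congr (_ + _).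
  by rewrite [LHS]mxE mul_mx_scalar -scalemxAl [X in - X]mxE.
have pN : psdmx (M - (f v)%:M).
  split=> // x; rewrite qE subr_ge0.
  have [->|x0] := eqVneq x 0.
    by rewrite /f trmx0 !mul0mx [fun_of_matrix 0 _ _]mxE mulr0.
  have : x^T != 0 by rewrite trmx_eq0.
  move=> /rv_sqnorm_gt0; rewrite trmxK; set s := (x^T *m x) 0 0 => s0.
  (* Minimality is tested at the normalised vector; homogeneity carries it back to x. *)
  have : f v <= f ((Num.sqrt s)^-1 *: x^T).
    apply: vmin; rewrite inE /A /= mulmx1 linearZ /= -scalemxAl -scalemxAr.
    rewrite scalerA mxE trmxK -/s -invfM -expr2 sqr_sqrtr ?(ltW s0) //.
    by rewrite mulVf // gt_eqF.
  rewrite {2}/f linearZ /= -!scalemxAl -scalemxAr scalerA -invfM -expr2.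
  by rewrite sqr_sqrtr ?(ltW s0) // mxE mulrC ler_pdivlMr.
exists (f v) => //; apply/eigenvalueP; exists v; last first.
  apply: contraPneq v1 => ->; rewrite mul0mx mxE => /eqP.
  by rewrite eq_sym oner_eq0.
(* The shifted form vanishes at v, so Cauchy-Schwarz against each basis vector forces every entry of
   v (M - a I) to be zero. *)
apply/eqP; rewrite -subr_eq0 -mul_mx_scalar -mulmxBr; apply/eqP/rowP => j.
have := psdmx_cauchy_schwarz v^T (delta_mx j 0) pN.
rewrite qE trmxK v1 mulr1 subrr mul0r -colE exprn_even_le0 //= mxE => /eqP ->.
by rewrite mxE.
Qed.

(** The eigenvalue a of [rayleigh_min] lies below all others, as testing the form on an eigenvector
    shows, so it is the value that [xget] selects. For n = 0 there is no eigenvalue, but all forms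
    are zero. *)
Lemma psdmx_lambda_min n (M : 'M[R]_n) : M^T = M ->
  psdmx (M - (lambda_min M)%:M).
Proof.
move=> sM; have [n0|n0] := posnP n.
  subst n; split=> [|x]; first by rewrite [LHS]flatmx0 [RHS]flatmx0.
  by rewrite /qform [x^T]thinmx0 !mul0mx mxE.
have [a eva pa] := rayleigh_min sM n0.
have amin mu : eigenvalue M mu -> a <= mu.
  move=> /eigenvalueP[v vM v0]; have := pa.2 v^T.
  rewrite /qform trmxK mulmxBr vM mul_mx_scalar -scalerBl -scalemxAl mxE.
  by rewrite pmulr_lge0 ?subr_ge0 // rv_sqnorm_gt0.
have [ev le] : eigenvalue M (lambda_min M) /\
    forall mu, eigenvalue M mu -> lambda_min M <= mu.
  apply: (@xgetPex R 0 [set l | eigenvalue M l /\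
    forall mu, eigenvalue M mu -> l <= mu]).
  by exists a.
rewrite (_ : lambda_min M = a) //.
by apply/eqP; rewrite eq_le le // amin.
Qed.

End PositiveDefinite.

(** * One step of the algorithms *)

Section SketchAndProject.
Variables (R : realType) (n : nat).
Implicit Types A B X Z E : 'M[R]_n.

Lemma sqnormFB_ge0 B X : posdefmx B -> 0 <= sqnormFB B X.
Proof.
move=> /posdefmx_psd pB; apply: mxtrace_psd_mul_ge0 => //.
exact: psdmx_congr.
Qed.

(** For C a square root of B^-1, the inverse D of C satisfies D D = B. Semidefiniteness of C E C - l
    I is tested on D X D: the inner factors D cancel the factors C, and the outer ones recombine
    into B by cyclicity of the trace. *)
Lemma sqnormFB_lambda_min_le B E X : posdefmx B -> psdmx E ->
  let C := sqrtmx (invmx B) in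
  lambda_min (C *m E *m C) * sqnormFB B X <= \tr (X^T *m E *m X *m B).
Proof.
move=> pB pE; have psB := posdefmx_psd pB.
rewrite /sqrtmx; case: xgetP => [C _ [/[dup] pC /posdefmx_psd [sC _] CC]|_] /=.
  have uC := posdefmx_unit pC; pose D := invmx C.
  have sD : D^T = D by rewrite /D trmx_inv sC.
  have DD : D *m D = B.
    apply: (can_inj (mulKmx (posdefmx_unit (posdefmx_inv pB)))).
    by rewrite mulVmx ?posdefmx_unit // -CC mulmxA mulmxK // mulmxV.
  have cyc N : \tr (D *m (N *m D)) = \tr (N *m B).
    by rewrite mxtrace_mulC -mulmxA DD.
  have sM : (C *m E *m C)^T = C *m E *m C by rewrite !trmx_mul sC pE.1 mulmxA.
  have := mxtrace_psd_ge0 (psdmx_congr (D *m X *m D) (psdmx_lambda_min sM)).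
  set l := lambda_min _.
  rewrite mulmxBr mulmxBl mul_mx_scalar -scalemxAl raddfB /= mxtraceZ subr_ge0.
  rewrite !trmx_mul sD.
  have -> : D *m (X^T *m D) *m (D *m X *m D) = D *m (X^T *m B *m X *m D).
    by rewrite -DD !mulmxA.
  have -> : D *m (X^T *m D) *m (C *m E *m C) *m (D *m X *m D) =
      D *m (X^T *m E *m X *m D).
    by rewrite !mulmxA mulmxK // mulmxKV.
  by rewrite !cyc.
(* Without a square root, the junk value 0 makes the left-hand side <= 0. *)
rewrite mulmx0; set l := lambda_min 0.
apply: (@le_trans _ _ 0); last first.
  by apply: mxtrace_psd_mul_ge0 => //; exact: psdmx_congr.
rewrite mulr_le0_ge0 ?sqnormFB_ge0 //.
(* For n > 0, a diagonal entry of the semidefinite matrix 0 - l I gives l <= 0. For n = 0 there is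
   no eigenvector, and [lambda_min] takes its default value 0. *)
have [n0|n0] := posnP n; last first.
  have /(psdmx_diag_ge0 (Ordinal n0)) := psdmx_lambda_min (trmx0 R n n).
  by rewrite sub0r !mxE eqxx mulr1n oppr_ge0.
rewrite /l; subst n.
rewrite /lambda_min; case: xgetP => // a _ [/eigenvalueP[v _]].
by rewrite thinmx0 eqxx.
Qed.

(** With Y = A^T S and K = Y^T B^-1 Y, Z equals Y K^-1 Y^T. Full column rank of S passes to Y, so K
    is positive definite; then Z is a congruence of K^-1, and Z B^-1 Z = Y K^-1 K K^-1 Y^T
    collapses. *)
Lemma Zmx_psd_proj A B (s : nrowmx R n) : A \in unitmx -> posdefmx B ->
  full_col_rank s ->
  psdmx (Zmx A B s) /\ Zmx A B s *m invmx B *m Zmx A B s = Zmx A B s.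
Proof.
move=> uA pB rs; have pVB := posdefmx_inv pB.
rewrite /Zmx; set S := sketchmx s; pose Y := A^T *m S.
have -> : S^T *m A *m invmx B *m A^T *m S = Y^T *m invmx B *m Y.
  by rewrite /Y trmx_mul trmxK !mulmxA.
have pK : posdefmx (Y^T *m invmx B *m Y).
  apply: posdefmx_congr => //; rewrite /row_free /Y trmx_mul trmxK.
  by rewrite mxrankMfree ?row_free_unit // mxrank_tr rs.
have uK := posdefmx_unit pK.
have -> K : A^T *m S *m K *m S^T *m A = Y *m K *m Y^T.
  by rewrite /Y trmx_mul trmxK !mulmxA.
split.
  rewrite -{1}[Y]trmxK; apply: psdmx_congr; apply: posdefmx_psd.
  exact: posdefmx_inv.
set K := _ *m _ *m Y in uK *.
have E : invmx K *m K *m invmx K = invmx K by rewrite mulVmx // mul1mx.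
rewrite -[in RHS]E /K.
by rewrite !mulmxA.
Qed.

Section Residual.
Variables (A B : 'M[R]_n) (Z : 'M[R]_n).
Hypotheses (pB : posdefmx B) (pZ : psdmx Z) (ZZ : Z *m invmx B *m Z = Z).

Let Q : 'M[R]_n := 1%:M - invmx B *m Z.

Let trQ : Q^T = 1%:M - Z *m invmx B.
Proof.
by rewrite linearB /= trmx1 trmx_mul pZ.1 (posdefmx_psd (posdefmx_inv pB)).1.
Qed.

Let QBQ : Q^T *m B *m Q = B - Z.
Proof.
rewrite trQ mulmxBl mul1mx mulmxKV ?posdefmx_unit // mulmxBr mulmx1.
rewrite mulmxBl !mulmxA mulmxV ?posdefmx_unit // mul1mx ZZ subrr.
by rewrite subr0.
Qed.

(** This also bounds the entries of the random Z in terms of B, which makes them integrable. *)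
Lemma psdmx_sub_proj : psdmx (B - Z).
Proof. by rewrite -QBQ; apply: psdmx_congr; exact: posdefmx_psd. Qed.

Lemma sqnormFB_proj X : sqnormFB B ((1%:M - invmx B *m Z) *m X) =
  sqnormFB B X - \tr (X^T *m Z *m X *m B).
Proof.
rewrite -/Q /sqnormFB trmx_mul -raddfB /= -!mulmxBl -mulmxBr -QBQ.
by rewrite !mulmxA.
Qed.

(** By cyclicity the left-hand side is tr (X^T (B - Z) X (B - Z)). Replacing the last factor by B
    adds tr (X^T (B - Z) X Z), a trace of a product of two semidefinite matrices. *)
Lemma sqnormFB_sym_proj X :
  sqnormFB B ((1%:M - invmx B *m Z) *m X *m (1%:M - Z *m invmx B)) <=
  sqnormFB B X - \tr (X^T *m Z *m X *m B).
Proof.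
rewrite -trQ -/Q /sqnormFB !trmx_mul trmxK.
have -> : \tr (Q *m (X^T *m Q^T) *m B *m (Q *m X *m Q^T) *m B) =
    \tr (X^T *m (B - Z) *m X *m (B - Z)).
  by rewrite -QBQ -!mulmxA [LHS]mxtrace_mulC !mulmxA.
rewrite [leRHS](_ : _ = \tr (X^T *m (B - Z) *m X *m B)); last first.
  by rewrite mulmxBr !mulmxBl raddfB.
rewrite [X in \tr X <= _]mulmxBr raddfB /= gerBl; apply: mxtrace_psd_mul_ge0 => //.
by apply: psdmx_congr; exact: psdmx_sub_proj.
Qed.

End Residual.

(** Since 1 - A X = - A (X - A^-1), the correction is - B^-1 Z (X - A^-1). *)
Lemma row_step_residual A B X s : A \in unitmx ->
  row_step A B X s - invmx A =
  (1%:M - invmx B *m Zmx A B s) *m (X - invmx A).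
Proof.
move=> uA; rewrite /row_step /Zmx mulmxBl mul1mx !mulmxBr !mulmxA mulmx1.
by rewrite (mulmxK uA) opprB [RHS]addrAC.
Qed.

(** Let r = X - A^-1. Then M = r A and A X A - A = A r A, while A Theta = Z B^-1 and Theta^T A =
    B^-1 Z because Lambda is symmetric. The four terms of the step are the expansion of the
    product. *)
Lemma sym_step_residual A B X s : A \in unitmx -> posdefmx B ->
  A^T = A -> X^T = X ->
  sym_step A B X s - invmx A =
  (1%:M - invmx B *m Zmx A B s) *m (X - invmx A) *m
    (1%:M - Zmx A B s *m invmx B).
Proof.
move=> uA /posdefmx_inv/posdefmx_psd[sB _] sA sX.
rewrite /sym_step /Zmx sA; set S := sketchmx s; set K := _ *m _ *m S.
set L := S *m invmx K *m S^T.
have sL : L^T = L.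
  by rewrite /L !trmx_mul trmxK trmx_inv /K !trmx_mul trmxK sA sB !mulmxA.
have -> : A *m S *m invmx K *m S^T *m A = A *m L *m A by rewrite /L !mulmxA.
clearbody L; rewrite !trmx_mul linearB /= trmx_mul trmx1 sA sB sL sX.
have AV : A *m (X - invmx A) = A *m X - 1%:M by rewrite mulmxBr mulmxV.
have VA : (X - invmx A) *m A = X *m A - 1%:M by rewrite mulmxBl mulVmx.
have AVA : A *m (X - invmx A) *m A = A *m X *m A - A.
  by rewrite AV mulmxBl mul1mx.
rewrite -AVA -AV -VA; set r := X - invmx A.
have -> (p q : 'M[R]_n) : (1%:M - p) *m r *m (1%:M - q) =
    r - r *m q - p *m r + p *m r *m q.
  clearbody r; rewrite mulmxBr mulmx1 !mulmxBl !mul1mx.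
  move: (p *m r *m q) (p *m r) (r *m q) => a b c.
  by apply/matrixP => i j; rewrite !mxE; ring.
by rewrite !mulmxA [LHS]addrAC 2!(addrAC _ _ (- invmx A)).
Qed.

Lemma sym_step_sym A B X s : posdefmx B ->
  A^T = A -> X^T = X -> (sym_step A B X s)^T = sym_step A B X s.
Proof.
move=> /posdefmx_inv/posdefmx_psd[sB _] sA sX.
rewrite /sym_step; set S := sketchmx s; set K := _ *m _ *m S.
set T := _ *m A *m invmx B; set M := X *m A - _; set N := _ - A.
have sN : N^T = N by rewrite /N linearB /= !trmx_mul sA sX mulmxA.
clearbody T M N; rewrite [LHS]linearD /= !linearB /= trmxK sX.
by rewrite [X - _ - _]addrAC !trmx_mul trmxK sN mulmxA.
Qed.

End SketchAndProject.

(** * Measurability of matrix-valued functions *)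

(** Inversion is continuous on the open complement of 0, and the singleton is handled apart. *)
Lemma measurable_inv (R : realType) : measurable_fun [set: R] (fun x => x^-1).
Proof.
have m0 : measurable [set (0 : R)] by exact: measurable_set1.
rewrite -(setUv [set 0]); apply/measurable_funU => //; first exact: measurableC.
split; first exact: measurable_fun_set1.
apply: open_continuous_measurable_fun.
  by rewrite openC; exact: closed_eq.
by move=> x; rewrite inE /= => /eqP x0; exact: inv_continuous.
Qed.

Section MeasurableMatrices.
Context (R : realType) (d : measure_display) (T : measurableType d).

Definition measurable_mx (D : set T) m n (M : T -> 'M[R]_(m, n)) : Prop :=
  forall i j, measurable_fun D (fun t => M t i j).

Variable D : set T.

Lemma measurable_mx_cst m n (M : 'M[R]_(m, n)) :
  measurable_mx D (fun=> M).
Proof. by move=> i j; exact: measurable_cst. Qed.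

Lemma measurable_mxD m n (M N : T -> 'M[R]_(m, n)) :
  measurable_mx D M -> measurable_mx D N ->
  measurable_mx D (fun t => M t + N t).
Proof.
move=> mM mN i j; under eq_fun do rewrite mxE.
by apply: measurable_funD; [exact: mM|exact: mN].
Qed.

Lemma measurable_mxB m n (M N : T -> 'M[R]_(m, n)) :
  measurable_mx D M -> measurable_mx D N ->
  measurable_mx D (fun t => M t - N t).
Proof.
move=> mM mN i j; rewrite (_ : (fun t => _) = (fun t => M t i j - N t i j)).
  by apply: measurable_funB; [exact: mM|exact: mN].
by apply/funext => t; rewrite !mxE.
Qed.

Lemma measurable_mx_mul m n p (M : T -> 'M[R]_(m, n)) (N : T -> 'M[R]_(n, p)) :
  measurable_mx D M -> measurable_mx D N ->
  measurable_mx D (fun t => M t *m N t).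
Proof.
move=> mM mN i j; under eq_fun do rewrite mxE.
apply: measurable_sum => k.
by apply: measurable_funM; [exact: mM|exact: mN].
Qed.

Lemma measurable_mx_tr m n (M : T -> 'M[R]_(m, n)) :
  measurable_mx D M -> measurable_mx D (fun t => (M t)^T).
Proof. by move=> mM i j; under eq_fun do rewrite mxE; exact: mM. Qed.

Lemma measurable_mxtrace n (M : T -> 'M[R]_n) :
  measurable_mx D M -> measurable_fun D (fun t => \tr (M t)).
Proof. by move=> mM; apply: measurable_sum => i; exact: mM. Qed.

Lemma measurable_det n (M : T -> 'M[R]_n) :
  measurable_mx D M -> measurable_fun D (fun t => \det (M t)).
Proof.
move=> mM; apply: measurable_sum => s.
apply: measurable_funM; first exact: measurable_cst.
by apply: measurable_prod => i _; exact: mM.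
Qed.

Lemma measurable_adj n (M : T -> 'M[R]_n) :
  measurable_mx D M -> measurable_mx D (fun t => \adj (M t)).
Proof.
move=> mM i j; under eq_fun do rewrite mxE.
apply: measurable_funM; first exact: measurable_cst.
apply: measurable_det => k l; under eq_fun do rewrite 2!mxE.
exact: mM.
Qed.

Lemma measurable_invmx n (M : T -> 'M[R]_n) : measurable D ->
  measurable_mx D M -> measurable_mx D (fun t => invmx (M t)).
Proof.
move=> mD mM i j.
(* On singular matrices [invmx] is the identity; elsewhere Cramer's formula applies. *)
have -> : (fun t => invmx (M t) i j) = (fun t =>
    if \det (M t) == 0 then M t i j else (\det (M t))^-1 * (\adj (M t)) i j).
  apply/funext => t; rewrite /invmx unitmxE unitfE.
  by case: eqVneq => //= _; rewrite [LHS]mxE.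
have mdet := measurable_det mM.
apply: measurable_fun_if => //.
- by apply: measurable_fun_eqr => //; exact: measurable_cst.
- by apply: measurable_funS (mM i j).
- apply: (@measurable_funS _ _ _ _ D) => //.
  apply: measurable_funM; last exact: measurable_adj.
  by apply: measurableT_comp mdet; exact: measurable_inv.
Qed.

End MeasurableMatrices.

Lemma measurable_mx_comp (R : realType) d1 d2 (T1 : measurableType d1)
    (T2 : measurableType d2) m n (M : T2 -> 'M[R]_(m, n)) (f : T1 -> T2) :
  measurable_mx setT M -> measurable_fun setT f ->
  measurable_mx setT (fun t => M (f t)).
Proof.
by move=> mM mf i j; exact: (measurableT_comp (mM i j) mf).
Qed.

(** * Measurability of functions of the sketch *)

Section SketchMeasurability.
Variables (R : realType) (n : nat).

Lemma open_measurable_nrowmx (U : set (nrowmx_sum R n)) :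
  open U -> measurable (U : set (nrowmx R n)).
Proof. by move=> oU; exact: sub_sigma_algebra. Qed.

(** Continuity on each summand makes preimages of open intervals open in the disjoint union. *)
Lemma measurable_nrowmx_fun (f : nrowmx_sum R n -> R) :
  (forall q, continuous (fun M : 'M[R]_(n, q) => f (existT _ q M))) ->
  measurable_fun setT (f : nrowmx R n -> R).
Proof.
move=> cf; apply: (measurability _ (RGenOpens.measurableE R)).
move=> _ [_ [a [b ->] <-]]; rewrite setTI; apply: open_measurable_nrowmx.
apply/sigT_openP => q.
have /continuousP := cf q; apply; exact: interval_open.
Qed.

Lemma measurable_ncols (q : nat) : measurable [set s : nrowmx R n | ncols s = q].
Proof.
apply: open_measurable_nrowmx; apply/sigT_openP => p.
have [->|pq] := eqVneq p q.
  by rewrite (_ : _ @^-1` _ = setT); [exact: openT|apply/seteqP; split].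
rewrite (_ : _ @^-1` _ = set0); first exact: open0.
by apply/seteqP; split=> // M /= /eqP; rewrite (negPf pq).
Qed.

(** Padding by 0 frees the column index from its dependence on s. *)
Definition sketch_coord (i : 'I_n) (j : nat) (s : nrowmx R n) : R :=
  if insub j is Some k then sketchmx s i k else 0.

Lemma measurable_sketch_coord i j : measurable_fun setT (sketch_coord i j).
Proof.
apply: measurable_nrowmx_fun => q; rewrite /sketch_coord /sketchmx /ncols /=.
by case: insub => [k|]; [exact: coord_continuous|exact: cst_continuous].
Qed.

(** The space is a countable union of measurable pieces with a fixed number q of columns. On each,
    the sketch agrees with a matrix N of fixed size, to which the closure lemmas apply. *)
Lemma measurable_sketch_inv (H : 'M[R]_n) :
  measurable_mx setT (fun s : nrowmx R n =>
    sketchmx s *m invmx ((sketchmx s)^T *m H *m sketchmx s) *m (sketchmx s)^T).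
Proof.
move=> i j.
have -> : [set: nrowmx R n] = \bigcup_q [set s | ncols s = q].
  by apply/seteqP; split=> // s _; exists (ncols s).
apply/measurable_fun_bigcup => q; first exact: measurable_ncols.
have mq := measurable_ncols q.
pose N (s : nrowmx R n) : 'M[R]_(n, q) := \matrix_(k, l) sketch_coord k l s.
have mN : measurable_mx [set s | ncols s = q] N.
  move=> k l; rewrite (_ : (fun t => N t k l) = sketch_coord k l).
    by apply: measurable_funTS; exact: measurable_sketch_coord.
  by apply/funext => s; rewrite mxE.
apply: (@eq_measurable_fun _ _ _ _ _ (fun s =>
    (N s *m invmx ((N s)^T *m H *m N s) *m (N s)^T) i j)); last first.
  have mNT := measurable_mx_tr mN.
  apply: measurable_mx_mul => //; apply: measurable_mx_mul => //.
  apply: measurable_invmx => //; apply: measurable_mx_mul => //.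
  by apply: measurable_mx_mul => //; exact: measurable_mx_cst.
case=> p M; rewrite inE /ncols /= => pq; subst p.
have -> : N (existT _ q M) = M.
  by apply/matrixP => k l; rewrite /N mxE /sketch_coord /= valK.
by [].
Qed.

End SketchMeasurability.

(** * Independence of the past *)

Section History.
Context {d d' : measure_display} {T : measurableType d}
  {T' : measurableType d'} {R : realType}.
Variables (P : probability T R) (X : nat -> {RV P >-> T'}).

(* A pi-system generating the sigma-algebra of X_0, ..., X_(k-1). *)
Definition history (k : nat) : set (set T) :=
  [set A | exists2 U : nat -> set T', forall j, measurable (U j) &
     A = \bigcap_(j in `I_k) (X j @^-1` U j)].

Lemma history_measurable k : history k `<=` measurable.
Proof.
move=> _ [U mU ->]; apply: fin_bigcap_measurable => // j _.
by rewrite -[_ @^-1` _]setTI; exact: measurable_funP.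
Qed.

Lemma history_setI_closed k : setI_closed (history k).
Proof.
move=> _ _ [U mU ->] [V mV ->]; exists (fun j => U j `&` V j).
  by move=> j; exact: measurableI.
by rewrite -bigcapI.
Qed.

Lemma history_setT k : history k setT.
Proof.
exists (fun=> setT) => //; apply/seteqP; split=> //.
Qed.

Lemma history_preimage k j (U : set T') : (j < k)%N -> measurable U ->
  history k (X j @^-1` U).
Proof.
move=> jk mU; exists (fun i => if i == j then U else setT).
  by move=> i; case: ifP.
apply/seteqP; split=> [t Ut i ik /=|t /(_ j jk)]; last by rewrite eqxx.
by case: eqP => // ->.
Qed.

Let TH k : measurableType _ := g_sigma_algebraType (history k).

Lemma measurable_fun_history k j : (j < k)%N ->
  measurable_fun setT (X j : TH k -> T').
Proof.
move=> jk _ U mU; rewrite setTI; apply: sub_sigma_algebra.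
exact: history_preimage.
Qed.

Lemma measurable_history_id k :
  measurable_fun setT (id : T -> TH k).
Proof.
move=> _ A mA; rewrite setTI preimage_id.
apply: smallest_sub mA; first exact: sigma_algebra_measurable.
exact: history_measurable.
Qed.

Hypothesis indepX : mutually_independent X.

(** As functions of A, both sides are finite measures that agree on the pi-system [history k], hence
    on the sigma-algebra it generates. *)
Lemma history_independent k (A : set T) (V : set T') :
  <<s history k >> A -> measurable V ->
  P (A `&` X k @^-1` V) = (P A * P (X k @^-1` V))%E.
Proof.
move=> hA mV.
have mXV : measurable (X k @^-1` V).
  by rewrite -[_ @^-1` _]setTI; exact: measurable_funP.
have PVfin : P (X k @^-1` V) \is a fin_num by exact: fin_num_measure.
pose r : {nonneg R} := NngNum (fine_ge0 (measure_ge0 P (X k @^-1` V))).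
have rE B : (mscale r P B = P B * P (X k @^-1` V))%E.
  by rewrite muleC -[in RHS](fineK PVfin).
rewrite -rE -[LHS]/(mrestr P mXV A).
apply: (g_sigma_algebra_measure_unique (history k) _ (fun=> setT)) hA.
- exact: history_measurable.
- by move=> _; exact: history_setT.
- by apply/seteqP; split=> // t _; exists 0%N.
- exact: history_setI_closed.
- move=> _ [U mU ->]; rewrite [RHS]rE /= /mrestr muleC.
  (* One family serves both the indices below k and those together with k; the quotient of the two
     product formulas is the factor at k. *)
  pose W j := if j == k then V else U j.
  have mW j : measurable (W j) by rewrite /W; case: ifP.
  pose J := [fset j in iota 0 k]%fset.
  have JE : [set` J] = `I_k.
    by apply/seteqP; split=> j; rewrite /= in_fset /= mem_iota.
  have Wlt j : j \in J -> W j = U j.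
    rewrite in_fset /= mem_iota add0n => /= jk.
    by rewrite /W; case: eqP jk => // ->; rewrite ltnn.
  have kJ : k \notin J by rewrite in_fset /= mem_iota add0n ltnn andbF.
  rewrite -JE.
  have -> : \bigcap_(j in [set` J]) (X j @^-1` U j) =
      \bigcap_(j in [set` J]) (X j @^-1` W j).
    by apply: eq_bigcapr => j jJ; rewrite Wlt.
  rewrite [in RHS](indepX J mW).
  have := indepX (k |` J)%fset mW; rewrite big_fsetU1 //= {2}/W eqxx => <-.
  rewrite set_fsetU set_fset1 bigcap_setU bigcap_set1 /W eqxx setIC //.
- by move=> _; apply: (@le_lt_trans _ _ (P setT));
   [apply: le_measure; rewrite ?inE //; exact: measurableI|
    rewrite probability_setT ltry].
Qed.

(** Independence identifies the joint law of the past and [X k] with the product of their laws;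
    Tonelli then integrates the sketch first. *)
Lemma integral_history k (f : TH k * T' -> \bar R) :
  measurable_fun setT f -> (forall z, (0 <= f z)%E) ->
  (\int[P]_t f (t, X k t) =
   \int[P]_t \int[distribution P (X k)]_s f (t, s))%E.
Proof.
move=> mf f0.
have mX : measurable_fun setT (X k) by exact: measurable_funP.
(* The past is encoded as the identity map into the coarser sigma-algebra, so its law is the
   restriction of P. *)
pose Y : {RV P >-> TH k} := mfun_Sub (mem_set (@measurable_history_id k)).
have mW : measurable_fun setT (fun t => (t, X k t) : TH k * T').
  by apply: measurable_fun_pair => //; exact: measurable_history_id.
pose W : {RV P >-> (TH k * T')%type} := mfun_Sub (mem_set mW).
rewrite -[LHS]/(\int[P]_t (f \o W) t)%E -ge0_integral_distribution //.
rewrite (eq_measure_integral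
   (distribution P Y \x distribution P (X k))%E); last first.
  move=> A mA _; apply/esym; apply: product_measure_unique => // B C mB mC.
  exact: history_independent.
rewrite fubini_tonelli1 //.
rewrite ge0_integral_distribution //.
- exact: measurable_fun_fubini_tonelli_F.
- by move=> t; apply: integral_ge0.
Qed.

End History.

(** * Expectations *)

Section Expectation.
Context {d : measure_display} {T : measurableType d} {R : realType}.
Variable P : probability T R.

Lemma ae_bounded_integrable (f : T -> R) (c : R) : measurable_fun setT f ->
  {ae P, forall t, `|f t| <= c} -> P.-integrable setT (EFin \o f).
Proof.
move=> mf [N [mN PN fN]]; apply/integrableP; split; first exact/measurable_EFinP.
apply: (@le_lt_trans _ _ (\int[P]_t `|c|%:E)%E).
  apply: ae_ge0_le_integral => //.
  - by apply: measurableT_comp => //; exact/measurable_EFinP.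
  - exists N; split=> // t /= ft; apply: fN => /= fc; apply: ft => _.
    by rewrite lee_fin (le_trans fc) ?ler_norm.
by rewrite integral_cst //= probability_setT mule1 ltry.
Qed.

(** Linearity of the integral, entry by entry; integrability ensures that [fine] in [expectmx] loses
    nothing. *)
Lemma integral_mxtrace_mulr n (Z : T -> 'M[R]_n) (W : 'M[R]_n) :
  (forall i j, P.-integrable setT (fun t => (Z t i j)%:E)) ->
  (\int[P]_t (\tr (Z t *m W))%:E = (\tr (expectmx P Z *m W))%:E)%E.
Proof.
move=> iZ.
have -> : (fun t => (\tr (Z t *m W))%:E) =
    (fun t => \sum_i \sum_j (W j i)%:E * (Z t i j)%:E)%E.
  apply/funext => t; rewrite /mxtrace -sumEFin; apply: eq_bigr => i _.
  by rewrite mxE -sumEFin; apply: eq_bigr => j _; rewrite -EFinM mulrC.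
rewrite integral_sum //; last first.
  by move=> i; apply: integrable_sum => // j _; exact: integrableZl.
rewrite /mxtrace -sumEFin; apply: eq_bigr => i _.
rewrite integral_sum //; last by move=> j; exact: integrableZl.
rewrite mxE -sumEFin; apply: eq_bigr => j _.
rewrite integralZl // !mxE unlock mulrC EFinM fineK //.
exact: integrable_fin_num.
Qed.

Lemma ae_integral_le_sub (g h : T -> R) (c : R) :
  measurable_fun setT g -> P.-integrable setT (EFin \o h) ->
  (forall t, 0 <= g t) -> {ae P, forall t, g t <= c - h t} ->
  (\int[P]_t (g t)%:E <= c%:E - \int[P]_t (h t)%:E)%E.
Proof.
move=> mg ih g0 [N [mN PN gN]].
have mh : measurable_fun setT h.
  by apply/measurable_EFinP; exact: measurable_int ih.
have mch : measurable_fun setT (fun t => c - h t).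
  by apply: measurable_funB => //; exact: measurable_cst.
have <- : (\int[P]_t (c - h t)%:E = c%:E - \int[P]_t (h t)%:E)%E.
  have C : (\int[P]_t (cst c t)%:E = c%:E)%E.
    have := integral_cst P (@measurableT _ T) c%:E.
    by rewrite /= probability_setT mule1.
  rewrite -[in RHS]C -integralB_EFin //.
  exact: finite_measure_integrable_cst.
(* c - h is nonnegative only almost everywhere; the absolute value makes it so everywhere, as the
   comparison of integrals demands. *)
rewrite [leRHS](@ae_eq_integral _ _ _ _ setT (fun t => `|c - h t|%:E)); first last.
- exists N; split=> // t /= ct; apply: gN => /= gc; apply: ct => _.
  by rewrite /= ger0_norm // (le_trans (g0 t) gc).
- by apply/measurable_EFinP; apply: measurableT_comp.
- exact/measurable_EFinP.
- by [].
apply: ae_ge0_le_integral => //.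
- by move=> t _; rewrite lee_fin.
- exact/measurable_EFinP.
- by apply/measurable_EFinP; apply: measurableT_comp.
- exists N; split=> // t /= ct; apply: gN => /= gc; apply: ct => _.
  by rewrite lee_fin (le_trans gc) ?ler_norm.
Qed.

End Expectation.

(** * Measurability of the two steps *)

Section StepMeasurability.
Context {R : realType} {n : nat}.
Variables (A B : 'M[R]_n).

(** The source space is quantified because steps are taken on T, on T with the history
    sigma-algebra, and on the product of the latter with the sketch space. *)
Definition measurable_step (step : 'M[R]_n -> nrowmx R n -> 'M[R]_n) : Prop :=
  forall d' (T' : measurableType d') (X : T' -> 'M[R]_n) (s : T' -> nrowmx R n),
  measurable_mx setT X -> measurable_fun setT s ->
  measurable_mx setT (fun t => step (X t) (s t)).

Lemma measurable_step_row : measurable_step (row_step A B).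
Proof.
move=> d' T' X s mX ms.
have mL := measurable_mx_comp (measurable_sketch_inv (A *m invmx B *m A^T)) ms.
have mA := @measurable_mx_cst R _ T' setT _ _ A.
have mC := @measurable_mx_cst R _ T' setT _ _ (invmx B *m A^T).
have m1 := @measurable_mx_cst R _ T' setT _ _ (1%:M : 'M[R]_n).
have : measurable_mx setT (fun t => X t + (invmx B *m A^T) *m
    (sketchmx (s t) *m invmx ((sketchmx (s t))^T *m (A *m invmx B *m A^T) *m
      sketchmx (s t)) *m (sketchmx (s t))^T) *m (1%:M - A *m X t)).
  apply: measurable_mxD => //; apply: measurable_mx_mul.
    exact: measurable_mx_mul.
  by apply: measurable_mxB => //; exact: measurable_mx_mul.
by under eq_fun do rewrite /row_step !mulmxA.
Qed.

Lemma measurable_step_sym : measurable_step (sym_step A B).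
Proof.
move=> d' T' X s mX ms.
have mL := measurable_mx_comp (measurable_sketch_inv (A *m invmx B *m A)) ms.
have mA := @measurable_mx_cst R _ T' setT _ _ A.
have mV := @measurable_mx_cst R _ T' setT _ _ (invmx B).
have m1 := @measurable_mx_cst R _ T' setT _ _ (1%:M : 'M[R]_n).
pose Theta t := sketchmx (s t) *m invmx ((sketchmx (s t))^T *m A *m invmx B *m
  A *m sketchmx (s t)) *m (sketchmx (s t))^T *m A *m invmx B.
have mT : measurable_mx setT Theta.
  apply: measurable_mx_mul => //; apply: measurable_mx_mul => //.
  by move: mL; under eq_fun do rewrite !mulmxA.
have mM : measurable_mx setT (fun t => (X t *m A - 1%:M) *m Theta t).
  apply: measurable_mx_mul => //.
  by apply: measurable_mxB => //; exact: measurable_mx_mul.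
change (measurable_mx setT (fun t => X t - (X t *m A - 1%:M) *m Theta t -
  ((X t *m A - 1%:M) *m Theta t)^T +
  (Theta t)^T *m (A *m X t *m A - A) *m Theta t)).
apply: measurable_mxD.
  apply: measurable_mxB; last exact: measurable_mx_tr.
  exact: measurable_mxB.
apply: measurable_mx_mul => //; apply: measurable_mx_mul.
  exact: measurable_mx_tr.
apply: measurable_mxB => //; apply: measurable_mx_mul => //.
exact: measurable_mx_mul.
Qed.

End StepMeasurability.

Lemma measurable_sqnormFB {R : realType} {d} {T : measurableType d} n
    (B C : 'M[R]_n) (X : T -> 'M[R]_n) : measurable_mx setT X ->
  measurable_fun setT (fun t => sqnormFB B (X t - C)).
Proof.
move=> mX; apply: measurable_mxtrace.
have mB := @measurable_mx_cst R _ T setT _ _ B.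
have mXC : measurable_mx setT (fun t => X t - C).
  by apply: measurable_mxB => //; exact: measurable_mx_cst.
do 3 apply: measurable_mx_mul => //.
exact: measurable_mx_tr.
Qed.

(** * Iterating the bound in expectation *)

Section Descent.
Context {d : measure_display} {T : measurableType d} {R : realType} {n : nat}.
Variables (P : probability T R) (S : {RV P >-> nrowmx R n}).
Variables (Sk : nat -> {RV P >-> nrowmx R n}).
Hypothesis iidS : iid_copies S Sk.
Variables (B C : 'M[R]_n) (step : 'M[R]_n -> nrowmx R n -> 'M[R]_n).
Variables (I : 'M[R]_n -> Prop) (r : R).
Hypotheses (pB : posdefmx B) (mstep : measurable_step step).
Hypothesis stepI : forall X s, I X -> I (step X s).
Hypothesis step_le : forall X, I X ->
  (\int[P]_t (sqnormFB B (step X (S t) - C))%:E <=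
   (r * sqnormFB B (X - C))%:E)%E.

Let it X0 k (t : T) := iterates step X0 (fun j => Sk j t) k.

(** The j-th iterate uses only the sketches of index below j, so the sketch of index k is still
    fresh at the k-th iterate. *)
Let measurable_it X0 j k : (j <= k)%N ->
  measurable_mx setT (it X0 j : g_sigma_algebraType (history Sk k) -> 'M[R]_n).
Proof.
elim: j => [_|j IH jk]; first exact: measurable_mx_cst.
apply: mstep; first exact: IH (ltnW jk).
exact: measurable_fun_history.
Qed.

Let it_I X0 k t : I X0 -> I (it X0 k t).
Proof. by move=> IX; elim: k => //= k IH; exact: stepI. Qed.

(** Induction on k: with the past frozen, integrating over the last sketch yields the factor r by
    [step_le], and the outer integral is the previous expectation. *)
Lemma expectation_iterates_le X0 k : I X0 ->
  (\int[P]_t (sqnormFB B (iterates step X0 (fun j => Sk j t) k - C))%:E <=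
   (r ^+ k * sqnormFB B (X0 - C))%:E)%E.
Proof.
(* Multiplying the induction hypothesis by r requires 0 <= r. *)
move=> IX; have [r0|r0] := leP 0 r; last first.
  (* If r < 0, then step_le forces sqnormFB B (X - C) = 0 whenever I X. *)
  have z X : I X -> sqnormFB B (X - C) = 0.
    move=> /step_le/(le_trans _) le_r; apply/eqP.
    rewrite eq_le (sqnormFB_ge0 _ pB) andbT -(nmulr_rge0 _ r0) -lee_fin le_r //.
    by apply: integral_ge0 => t _; rewrite lee_fin; exact: sqnormFB_ge0.
  rewrite (z _ IX) mulr0 integral0_eq // => t _.
  by rewrite z //; exact: it_I.
elim: k => [|k IH].
  have := integral_cst P (@measurableT _ T) (sqnormFB B (X0 - C))%:E.
  by rewrite /= probability_setT mule1 mul1r => ->.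
pose TH := g_sigma_algebraType (history Sk k).
pose f (z : TH * nrowmx R n) : \bar R :=
  (sqnormFB B (step (it X0 k z.1) z.2 - C))%:E.
have mf : measurable_fun setT f.
  apply/measurable_EFinP; apply: measurable_sqnormFB; apply: mstep.
    apply: (measurable_mx_comp (f := fst) (M := it X0 k : TH -> _)).
      exact: measurable_it.
    exact: measurable_fst.
  exact: measurable_snd.
have f0 z : (0 <= f z)%E by rewrite lee_fin; exact: sqnormFB_ge0.
rewrite -[leLHS]/(\int[P]_t f ((t : TH), Sk k t))%E.
rewrite (integral_history iidS.1 mf f0).
have inner t : (\int[distribution P (Sk k)]_s f (t, s) <=
    r%:E * (sqnormFB B (it X0 k t - C))%:E)%E.
  have mft : measurable_fun setT (fun s => f (t, s)).
    by apply: measurableT_comp mf _; exact: measurable_pair1.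
  (* [step_le] speaks of S, which has the same law as the k-th sketch. *)
  rewrite (eq_measure_integral (distribution P S)); last first.
    by move=> A mA _; exact: iidS.2.
  rewrite ge0_integral_distribution; [|exact: mft|by move=> s; exact: f0].
  rewrite -EFinM; exact: step_le (it_I k t IX).
have mphi : measurable_fun setT (fun t => (sqnormFB B (it X0 k t - C))%:E).
  apply/measurable_EFinP; apply: measurable_sqnormFB.
  apply: (measurable_mx_comp (f := id : T -> TH) (M := it X0 k : TH -> _)).
    exact: measurable_it.
  exact: measurable_history_id.
apply: (@le_trans _ _ (\int[P]_t (r%:E * (sqnormFB B (it X0 k t - C))%:E))%E).
  apply: ge0_le_integral => //.
  - by move=> t _; exact: integral_ge0.
  - apply: (measurableT_comp (f := fun t : TH =>
      (\int[distribution P (Sk k)]_s f (t, s))%E)).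
      exact: measurable_fun_fubini_tonelli_F.
    exact: measurable_history_id.
  - by apply: measurable_funeM.
rewrite ge0_integralZl //; last by move=> t _; rewrite lee_fin; exact: sqnormFB_ge0.
by rewrite exprS -mulrA EFinM lee_wpmul2l ?lee_fin.
Qed.

End Descent.

(** * The bound in expectation for one step *)

Section OneStep.
Context {d : measure_display} {T : measurableType d} {R : realType} {n : nat}.
Variables (P : probability T R) (S : {RV P >-> nrowmx R n}) (A B : 'M[R]_n).
Hypotheses (uA : A \in unitmx) (pB : posdefmx B).
Hypothesis fullS : {ae P, forall t, full_col_rank (S t)}.
Hypothesis pE : posdefmx (expectmx P (fun t => Zmx A B (S t))).

Let measurable_Zmx : measurable_mx setT (fun t => Zmx A B (S t)).
Proof.
have mS : measurable_fun setT S by exact: measurable_funP.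
have mL := measurable_mx_comp (measurable_sketch_inv (A *m invmx B *m A^T)) mS.
have mA := @measurable_mx_cst R _ T setT _ _ A.
have mAT := @measurable_mx_cst R _ T setT _ _ A^T.
have : measurable_mx setT (fun t => A^T *m (sketchmx (S t) *m
    invmx ((sketchmx (S t))^T *m (A *m invmx B *m A^T) *m sketchmx (S t)) *m
    (sketchmx (S t))^T) *m A) by do 2 apply: measurable_mx_mul => //.
by under eq_fun do rewrite !mulmxA.
Qed.

(** Almost surely Z and B - Z are semidefinite, so the square of an entry of Z is at most
    [Z i i * Z j j <= B i i * B j j], hence at most the square of [B i i + B j j]. *)
Let integrable_Zmx i j :
  P.-integrable setT (fun t => (Zmx A B (S t) i j)%:E).
Proof.
apply: (@ae_bounded_integrable _ _ _ P _ (B i i + B j j)).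
  exact: measurable_Zmx.
apply: filterS fullS => t /(Zmx_psd_proj uA pB)[pZ ZZ].
have pBZ := psdmx_sub_proj pB pZ ZZ.
have ZB k : Zmx A B (S t) k k <= B k k.
  by have := psdmx_diag_ge0 k pBZ; rewrite mxE [X in B k k + X]mxE subr_ge0.
have Z0 k := psdmx_diag_ge0 k pZ.
have B0 k : 0 <= B k k by exact: le_trans (Z0 k) (ZB k).
rewrite -(ler_pXn2r (n := 2)) ?nnegrE ?addr_ge0 // real_normK ?num_real //.
apply: le_trans (psdmx_entry_sqr_le i j pZ) _.
apply: (@le_trans _ _ (B i i * B j j)); first exact: ler_pM.
by have := B0 i; have := B0 j; nra.
Qed.

Lemma one_step_le (step : 'M[R]_n -> nrowmx R n -> 'M[R]_n) (X : 'M[R]_n) :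
  measurable_step step ->
  (forall s, full_col_rank s ->
    sqnormFB B (step X s - invmx A) <= sqnormFB B (X - invmx A) -
      \tr ((X - invmx A)^T *m Zmx A B s *m (X - invmx A) *m B)) ->
  (\int[P]_t (sqnormFB B (step X (S t) - invmx A))%:E <=
   (rho A B S * sqnormFB B (X - invmx A))%:E)%E.
Proof.
move=> mstep le_step; set Y := X - invmx A.
(* The drop of the squared norm, rotated cyclically to put the random factor first. *)
pose h t := \tr (Zmx A B (S t) *m (Y *m B *m Y^T)).
have hE Z : \tr (Y^T *m Z *m Y *m B) = \tr (Z *m (Y *m B *m Y^T)).
  by rewrite -!mulmxA mxtrace_mulC !mulmxA.
have Eh : (\int[P]_t (h t)%:E =
    (\tr (Y^T *m expectmx P (fun t => Zmx A B (S t)) *m Y *m B))%:E)%E.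
  by rewrite integral_mxtrace_mulr // hE.
have mh : measurable_fun setT h.
  apply: measurable_mxtrace; apply: measurable_mx_mul.
    exact: measurable_Zmx.
  exact: measurable_mx_cst.
have ih : P.-integrable setT (EFin \o h).
  rewrite (_ : _ \o _ = fun t => (\sum_i \sum_j
      ((Y *m B *m Y^T) j i)%:E * (Zmx A B (S t) i j)%:E)%E).
    apply: integrable_sum => // i _; apply: integrable_sum => // j _.
    exact: integrableZl.
  apply/funext => t /=; rewrite /h /mxtrace -sumEFin; apply: eq_bigr => i _.
  by rewrite mxE -sumEFin; apply: eq_bigr => j _; rewrite -EFinM mulrC.
apply: (@le_trans _ _ ((sqnormFB B Y)%:E - \int[P]_t (h t)%:E)%E).
  apply: ae_integral_le_sub => //.
  - apply: measurable_sqnormFB; apply: mstep; first exact: measurable_mx_cst.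
    exact: measurable_funP.
  - by move=> t; exact: sqnormFB_ge0.
  - by apply: filterS fullS => t /le_step; rewrite -/Y hE.
rewrite Eh -EFinB lee_fin /rho mulrBl mul1r lerD2l lerN2.
exact: sqnormFB_lambda_min_le (posdefmx_psd pE).
Qed.

End OneStep.

Theorem theorem36 (R : realType) (n : nat) (A B X0 : 'M[R]_n)
    (d : measure_display) (T : measurableType d) (P : probability T R)
    (S : {RV P >-> nrowmx R n}) (Sk : nat -> {RV P >-> nrowmx R n}) :
  A \in unitmx ->
  posdefmx B ->
  {ae P, forall t, full_col_rank (S t)} ->
  posdefmx (expectmx P (fun t => Zmx A B (S t))) ->
  iid_copies S Sk ->
  forall k : nat,
    ('E_P[fun t => sqnormFB B
            (iterates (row_step A B) X0 (fun j => Sk j t) k - invmx A)]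
       <= (rho A B S ^+ k * sqnormFB B (X0 - invmx A))%:E)%E
    /\
    (A \is symmetricmx -> X0 \is symmetricmx ->
     ('E_P[fun t => sqnormFB B
             (iterates (sym_step A B) X0 (fun j => Sk j t) k - invmx A)]
        <= (rho A B S ^+ k * sqnormFB B (X0 - invmx A))%:E)%E).
Proof.
move=> uA pB fullS pE iidS k; rewrite unlock; split=> [|/symmetricmx_tr sA].
  apply: (expectation_iterates_le iidS pB _ (I := fun=> True)) => // [|X _].
    exact: measurable_step_row.
  apply: one_step_le => // [|s fs]; first exact: measurable_step_row.
  have [pZ ZZ] := Zmx_psd_proj uA pB fs.
  by rewrite row_step_residual // sqnormFB_proj.
move=> /symmetricmx_tr sX0.
(* Symmetry is carried as the invariant because [sym_step_residual] requires it of each iterate. *)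
apply: (expectation_iterates_le iidS pB _ (I := fun X => X^T = X)) => //.
- exact: measurable_step_sym.
- by move=> X s; exact: sym_step_sym.
- move=> X sX; apply: one_step_le => // [|s fs]; first exact: measurable_step_sym.
  have [pZ ZZ] := Zmx_psd_proj uA pB fs.
  by rewrite sym_step_residual //; exact: sqnormFB_sym_proj.
Qed.
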